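(* Assume $1-h\gamma-h\frac{P_{\max}}{2M\bar w^{3/2}}\ge 0$. For $i=1,\dots,n$ let $$z_i=\max_{w\in X_2\cap X_4}w_i,\qquad y_i=\min_{w\in X_1\cap X_3}w_i .$$ Then $X\ne\emptyset$ if and only if $y\le z$ componentwise. Moreover, if $X\neq\emptyset$, then $z'=z$ and $y'=y$, where $z'_i=\max_{w\in X}w_i$ and $y'_i=\min_{w\in X}w_i$ for $i=1,\dots,n$.
   Context: Data: an integer $n\ge 2$; real constants $h,M,P_{\max},g,\mu,\gamma>0$, $c\ge 0$; real angles $\alpha_1,\dots,\alpha_{n-1}$; boundary values $w_{\rm init},w_{\rm fin}\ge 0$; a vector $w^{\max}\in\mathbb{R}^n$ of nonnegative upper bounds with $w^{\max}_1=w_{\rm init}$, $w^{\max}_n=w_{\rm fin}$; and the vector $w^{\min}\in\mathbb{R}^n$ with $w^{\min}_1=w_{\rm init}$, $w^{\min}_n=w_{\rm fin}$, $w^{\min}_i=0$ for $2\le i\le n-1$. The critical value $\bar w>0$ is the solution of $\frac{P_{\max}}{M\sqrt{\bar w}}=g\mu$. For $w\in\mathbb{R}^n$ and $i\in\{1,\dots,n-1\}$ put $f_i(w)=\frac1h(w_{i+1}-w_i)+\gamma w_i+g(\sin\alpha_i+c)$, and for $x\in\mathbb{R}$ put $m(x)=\min\{\frac{P_{\max}}{M\sqrt{x}},g\mu\}$, read as $m(x)=g\mu$ for all $x\le\bar w$ (including $x\le 0$) and $m(x)=\frac{P_{\max}}{M\sqrt x}$ for $x>\bar w$. All inequalities between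 vectors are componentwise. Define subsets of $\mathbb{R}^n$: $X_1=\{w: f_i(w)\le m(w_i),\ i=1,\dots,n-1,\ w\ge w^{\min}\}$; $X_2=\{w: f_i(w)\le m(w_i),\ i=1,\dots,n-1,\ w\le w^{\max}\}$; $X_3=\{w: -f_i(w)\le g\mu,\ i=1,\dots,n-1,\ w\ge w^{\min}\}$; $X_4=\{w: -f_i(w)\le g\mu,\ i=1,\dots,n-1,\ w\le w^{\max}\}$; $X=X_1\cap X_2\cap X_3\cap X_4$. *)

(* Defs.v *)
From HB Require Import structures.
From mathcomp Require Import all_boot all_order all_algebra.
From mathcomp Require Import all_classical all_reals all_analysis.

Set Implicit Arguments.
Unset Strict Implicit.
Unset Printing Implicit Defensive.

Import Order.TTheory GRing.Theory Num.Theory.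
Import numFieldNormedType.Exports.

Local Open Scope classical_set_scope.
Local Open Scope ring_scope.

(* Indices are shifted down by one: the mathematical w_1, ..., w_n are the
   entries 0, ..., n - 1 of a row vector, and i : 'I_n.-1 stands for an index
   in {1, ..., n - 1}; [cur i] and [next i] are then the positions of w_i and
   w_(i+1). *)
Definition cur n (i : 'I_n.-1) : 'I_n := widen_ord (leq_pred n) i.

Lemma next_subproof n (i : 'I_n.-1) : (i.+1 < n)%N.
Proof. by rewrite -ltn_predRL. Qed.

Definition next n (i : 'I_n.-1) : 'I_n := Ordinal (next_subproof i).

Definition vle (R : realType) n (u v : 'rV[R]_n) : Prop :=
  forall i, u 0 i <= v 0 i.

(* h is p_h, M is p_M, and so on; the critical value, the solution of
   Pmax / (M sqrt wbar) = g mu, is p_wbar. *)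
Record data (R : realType) (n : nat) := Data {
  p_h : R;
  p_M : R;
  p_Pmax : R;
  p_g : R;
  p_mu : R;
  p_gamma : R;
  p_c : R;
  p_alpha : 'I_n.-1 -> R;
  p_winit : R;
  p_wfin : R;
  p_wmax : 'rV[R]_n;
  p_wbar : R;
  p_h_gt0 : 0 < p_h;
  p_M_gt0 : 0 < p_M;
  p_Pmax_gt0 : 0 < p_Pmax;
  p_g_gt0 : 0 < p_g;
  p_mu_gt0 : 0 < p_mu;
  p_gamma_gt0 : 0 < p_gamma;
  p_c_ge0 : 0 <= p_c;
  p_winit_ge0 : 0 <= p_winit;
  p_wfin_ge0 : 0 <= p_wfin;
  p_wmax_ge0 : forall i, 0 <= p_wmax 0 i;
  p_wmax_first : forall i : 'I_n, i = 0%N :> nat -> p_wmax 0 i = p_winit;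
  p_wmax_last : forall i : 'I_n, i = n.-1 :> nat -> p_wmax 0 i = p_wfin;
  p_wbar_gt0 : 0 < p_wbar;
  p_wbar_eq : p_Pmax / (p_M * Num.sqrt p_wbar) = p_g * p_mu
}.

Section Sets.
Variables (R : realType) (n : nat) (D : data R n).
Implicit Types (w : 'rV[R]_n) (i : 'I_n.-1) (x : R).

Definition wmin : 'rV[R]_n :=
  \row_(j < n) if j == 0%N :> nat then p_winit D
               else if j == n.-1 :> nat then p_wfin D else 0.

Definition f i w : R :=
  1 / p_h D * (w 0 (next i) - w 0 (cur i)) + p_gamma D * w 0 (cur i)
  + p_g D * (sin (p_alpha D i) + p_c D).

Definition m x : R :=
  if x <= p_wbar D then p_g D * p_mu D else p_Pmax D / (p_M D * Num.sqrt x).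

Lemma m_minE x : 0 < x ->
  m x = Num.min (p_Pmax D / (p_M D * Num.sqrt x)) (p_g D * p_mu D).
Proof.
move=> x0; rewrite /m -(p_wbar_eq D).
have hM := p_M_gt0 D; have hP := p_Pmax_gt0 D; have hw := p_wbar_gt0 D.
have le u v : 0 < u -> u <= v ->
    p_Pmax D / (p_M D * Num.sqrt v) <= p_Pmax D / (p_M D * Num.sqrt u).
  move=> u0 uv; rewrite ler_pM2l// lef_pV2 ?posrE ?mulr_gt0 ?sqrtr_gt0//.
    by rewrite ler_pM2l// ler_wsqrtr.
  exact: lt_le_trans uv.
case: (leP x (p_wbar D)) => [xw|/ltW wx].
  by apply/esym/min_idPr/le.
by apply/esym/min_idPl/le.
Qed.

Definition X1 : set 'rV[R]_n :=
  [set w | (forall i, f i w <= m (w 0 (cur i))) /\ vle wmin w].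

Definition X2 : set 'rV[R]_n :=
  [set w | (forall i, f i w <= m (w 0 (cur i))) /\ vle w (p_wmax D)].

Definition X3 : set 'rV[R]_n :=
  [set w | (forall i, - f i w <= p_g D * p_mu D) /\ vle wmin w].

Definition X4 : set 'rV[R]_n :=
  [set w | (forall i, - f i w <= p_g D * p_mu D) /\ vle w (p_wmax D)].

Definition X : set 'rV[R]_n := X1 `&` X2 `&` X3 `&` X4.

End Sets.

(* [is_max A a]: the maximum of A exists (is attained) and equals a. *)
Definition is_max (R : realType) (A : set R) (a : R) : Prop :=
  A a /\ ubound A a.

Definition is_min (R : realType) (A : set R) (a : R) : Prop :=
  A a /\ lbound A a.

Definition coord_max (R : realType) n (S : set 'rV[R]_n) (z : 'rV[R]_n) :=
  forall i, is_max [set w 0 i | w in S] (z 0 i).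

Definition coord_min (R : realType) n (S : set 'rV[R]_n) (y : 'rV[R]_n) :=
  forall i, is_min [set w 0 i | w in S] (y 0 i).

(* Main.v *)
Require Import Defs.
From HB Require Import structures.
From mathcomp Require Import all_boot all_order all_algebra.
From mathcomp Require Import all_classical all_reals all_analysis.
From mathcomp Require Import ring lra.

Set Implicit Arguments.
Unset Strict Implicit.
Unset Printing Implicit Defensive.

Import Order.TTheory GRing.Theory Num.Theory.
Import numFieldNormedType.Exports.

Local Open Scope classical_set_scope.
Local Open Scope ring_scope.

(* Writing a = 1 - h gamma, the constraints on (w_i, w_(i+1)) read
   L_i(w_i) <= w_(i+1) <= U_i(w_i), where L_i is affine of slope a and
   U_i(x) = a x + h m(x) + const. The step condition makes a positive and U_i
   nondecreasing; as m is nonincreasing, U_i is also a-Lipschitz from above.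
   Hence the set of solutions is closed under componentwise suprema and infima,
   so that the vector z of maxima (resp. y of minima) lies itself in X2 and X4
   (resp. X1 and X3); if y <= z, then z and y satisfy all the constraints. *)

(** * Componentwise suprema and infima of sets of vectors *)

Section RowSup.
Variables (R : realType) (n : nat).
Implicit Types (S : set 'rV[R]_n) (w v : 'rV[R]_n).

Definition rowsup S : 'rV[R]_n := \row_i sup [set w 0 i | w in S].
Definition rowinf S : 'rV[R]_n := \row_i inf [set w 0 i | w in S].

Lemma rowsup_ge S b w : (forall v, S v -> vle v b) -> S w -> vle w (rowsup S).
Proof.
move=> Sb Sw i; rewrite mxE; apply: ub_le_sup; last by exists w.
by exists (b 0 i) => _ [v /Sb vb <-].
Qed.

Lemma rowsup_le S i r : S !=set0 -> (forall w, S w -> w 0 i <= r) ->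
  rowsup S 0 i <= r.
Proof.
move=> [w Sw] Sr; rewrite mxE; apply: ge_sup; first by exists (w 0 i), w.
by move=> _ [v /Sr vr <-].
Qed.

Lemma rowinf_le S b w : (forall v, S v -> vle b v) -> S w -> vle (rowinf S) w.
Proof.
move=> Sb Sw i; rewrite mxE; apply: ge_inf; last by exists w.
by exists (b 0 i) => _ [v /Sb vb <-].
Qed.

Lemma rowinf_ge S i r : S !=set0 -> (forall w, S w -> r <= w 0 i) ->
  r <= rowinf S 0 i.
Proof.
move=> [w Sw] Sr; rewrite mxE; apply: lb_le_inf; first by exists (w 0 i), w.
by move=> _ [v /Sr vr <-].
Qed.

Lemma coord_max_greatest S z : S z -> (forall w, S w -> vle w z) ->
  coord_max S z.
Proof. by move=> Sz zub i; split=> [|_ [w /zub wz <-]//]; exists z. Qed.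

Lemma coord_min_least S y : S y -> (forall w, S w -> vle y w) ->
  coord_min S y.
Proof. by move=> Sy ylb i; split=> [|_ [w /ylb yw <-]//]; exists y. Qed.

End RowSup.

(** * The constraints as bounds on each entry in terms of the previous one *)

Section Step.
Variables (R : realType) (n : nat) (D : data R n).
Hypothesis Hstep : 0 <= 1 - p_h D * p_gamma D
  - p_h D * (p_Pmax D / (2 * p_M D * p_wbar D `^ (3 / 2))).
Implicit Types (w : 'rV[R]_n) (i : 'I_n.-1) (x y r : R).

Let a : R := 1 - p_h D * p_gamma D.

(** The value of w_(i+1) that solves f_i(w) = r when w_i = x. Taking r = m(x) gives U_i, and r = - g
    mu gives L_i. *)
Definition step i r x : R :=
  (1 - p_h D * p_gamma D) * x
  + p_h D * (r - p_g D * (sin (p_alpha D i) + p_c D)).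

Lemma f_step i w r : w 0 (Defs.next i) - step i r (w 0 (cur i)) =
  p_h D * (f D i w - r).
Proof. by have h0 := p_h_gt0 D; rewrite /step /f; field; rewrite gt_eqF. Qed.

Lemma f_leE i w r :
  (f D i w <= r) = (w 0 (Defs.next i) <= step i r (w 0 (cur i))).
Proof.
by rewrite -[RHS]subr_le0 f_step pmulr_rle0 ?p_h_gt0// subr_le0.
Qed.

Lemma f_geE i w r :
  (- f D i w <= r) = (step i (- r) (w 0 (cur i)) <= w 0 (Defs.next i)).
Proof.
by rewrite -[RHS]subr_ge0 f_step pmulr_rge0 ?p_h_gt0// subr_ge0 lerNl.
Qed.

Lemma powR_3half x : 0 < x -> x `^ (3 / 2) = Num.sqrt x ^+ 3.
Proof.
move=> x0; have -> : 3 / 2 = 2^-1 * 3%:R :> R by rewrite mulrC.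
by rewrite powRrM powR_mulrn ?powR_ge0// powR12_sqrt// ltW.
Qed.

(** By the equation defining [p_wbar], g mu is the value of the second branch at [p_wbar], so
    truncating the argument there removes the case split. *)
Lemma mE x : m D x = p_Pmax D / (p_M D * Num.sqrt (Num.max x (p_wbar D))).
Proof.
by rewrite /m; case: (leP x (p_wbar D)) => // _; rewrite -(p_wbar_eq D).
Qed.

Lemma m_gt0 x : 0 < m D x.
Proof.
rewrite mE divr_gt0 ?p_Pmax_gt0// mulr_gt0 ?p_M_gt0// sqrtr_gt0.
by rewrite lt_max p_wbar_gt0 orbT.
Qed.

Lemma m_le x y : x <= y -> m D y <= m D x.
Proof.
move=> xy; have wb := p_wbar_gt0 D; have M0 := p_M_gt0 D.
have max0 z : 0 < Num.max z (p_wbar D) by rewrite lt_max wb orbT.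
rewrite !mE ler_pM2l ?p_Pmax_gt0// lef_pV2 ?posrE ?mulr_gt0 ?sqrtr_gt0//.
by rewrite ler_pM2l// ler_wsqrtr// ge_max !le_max xy lexx orbT.
Qed.

Lemma slope_gt0 : 0 < a.
Proof.
rewrite /a; apply: lt_le_trans (_ : p_h D *
  (p_Pmax D / (2 * p_M D * p_wbar D `^ (3 / 2))) <= _); last by rewrite -subr_ge0.
rewrite mulr_gt0 ?p_h_gt0// divr_gt0 ?p_Pmax_gt0//.
by rewrite !mulr_gt0 ?p_M_gt0 ?powR_gt0 ?p_wbar_gt0.
Qed.

(* The mean value inequality for x |-> 1 / sqrt x between p ^+ 2 and q ^+ 2. *)
Lemma invB_le (s p q : R) : 0 < s -> s <= p -> p <= q ->
  p^-1 - q^-1 <= (q ^+ 2 - p ^+ 2) / (2 * s ^+ 3).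
Proof.
move=> s0 sp pq; have p0 : 0 < p by lra. have q0 : 0 < q by lra.
have -> : p^-1 - q^-1 = (q - p) * (p * q)^-1 by field; rewrite !gt_eqF.
have -> : (q ^+ 2 - p ^+ 2) / (2 * s ^+ 3) = (q - p) * ((p + q) / (2 * s ^+ 3)).
  by field; rewrite gt_eqF.
rewrite ler_wpM2l ?subr_ge0// ler_pdivlMr ?mulr_gt0 ?exprn_gt0//.
rewrite ler_pdivrMl ?mulr_gt0//.
have -> : 2 * s ^+ 3 = s * s * (s + s) by ring.
by rewrite !ler_pM ?mulr_ge0 ?addr_ge0 ?lerD//; lra.
Qed.

(** Between [x] and [y], m drops by at most K (y - x), where K = Pmax / (2 M wbar^(3/2)); the step
    condition says h K <= a, so the linear growth compensates the loss. *)
Lemma step_m_le i x y : x <= y -> step i (m D x) x <= step i (m D y) y.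
Proof.
move=> xy; have wb := p_wbar_gt0 D; have h0 := p_h_gt0 D.
have M0 := p_M_gt0 D; have P0 := p_Pmax_gt0 D.
set s := Num.sqrt (p_wbar D); have s0 : 0 < s by rewrite sqrtr_gt0.
(* Truncation keeps both roots above [s], as [invB_le] requires, and does not increase distances. *)
pose mx t := Num.max t (p_wbar D); pose q t := Num.sqrt (mx t).
have mx0 t : 0 <= mx t by rewrite le_max (ltW wb) orbT.
have q_ge t : s <= q t by rewrite ler_wsqrtr// le_max lexx orbT.
have qxy : q x <= q y by rewrite ler_wsqrtr// ge_max !le_max xy lexx orbT.
have q2 t : q t ^+ 2 = mx t by rewrite sqr_sqrtr.
have mxB : mx y - mx x <= y - x.
  by rewrite /mx; case: (leP y); case: (leP x) => *; lra.
pose K := p_Pmax D / (2 * p_M D * s ^+ 3).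
have K0 : 0 <= K by rewrite ltW// divr_gt0// !mulr_gt0 ?exprn_gt0.
have mB : m D x - m D y <= K * (y - x).
  rewrite !mE -/(mx x) -/(mx y) -/(q x) -/(q y).
  have qx0 : 0 < q x by apply: lt_le_trans (q_ge x).
  have qy0 : 0 < q y by apply: lt_le_trans (q_ge y).
  have -> : p_Pmax D / (p_M D * q x) - p_Pmax D / (p_M D * q y)
      = p_Pmax D / p_M D * ((q x)^-1 - (q y)^-1).
    by field; rewrite !gt_eqF.
  apply: le_trans (_ : K * (mx y - mx x) <= _); last by rewrite ler_wpM2l.
  have -> : K * (mx y - mx x) =
      p_Pmax D / p_M D * ((q y ^+ 2 - q x ^+ 2) / (2 * s ^+ 3)).
    by rewrite /K !q2; field; rewrite !gt_eqF.
  by rewrite ler_wpM2l ?invB_le// ltW ?divr_gt0.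
have hK : p_h D * K <= a by rewrite -subr_ge0 /K /s -powR_3half.
have yx : 0 <= y - x by rewrite subr_ge0.
have := ler_wpM2l (ltW h0) mB; have := ler_wpM2r yx hK.
by rewrite /step -/a; lra.
Qed.

Lemma step_m_lip i x y : x <= y ->
  step i (m D y) y <= step i (m D x) x + a * (y - x).
Proof.
move=> /m_le mxy; have := ler_wpM2l (ltW (p_h_gt0 D)) mxy.
by rewrite /step -/a; lra.
Qed.

(** The bounds by [wmin] and [p_wmax] are left out, so that the maximal and minimal problems share
    this condition. *)
Definition feasible w := forall i,
  step i (- (p_g D * p_mu D)) (w 0 (cur i)) <= w 0 (Defs.next i)
    <= step i (m D (w 0 (cur i))) (w 0 (cur i)).

Lemma X24E w : (X2 D `&` X4 D) w <-> feasible w /\ vle w (p_wmax D).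
Proof.
split=> [[[fm wM] [fg _]]|[fw wM]].
  by split=> // i; rewrite -f_leE -f_geE fm fg.
by split; split=> // i; rewrite ?f_leE ?f_geE; case/andP: (fw i).
Qed.

Lemma X13E w : (X1 D `&` X3 D) w <-> feasible w /\ vle (wmin D) w.
Proof.
split=> [[[fm wM] [fg _]]|[fw wM]].
  by split=> // i; rewrite -f_leE -f_geE fm fg.
by split; split=> // i; rewrite ?f_leE ?f_geE; case/andP: (fw i).
Qed.

Lemma XE w : X D w <-> [/\ feasible w, vle (wmin D) w & vle w (p_wmax D)].
Proof.
have -> : X D w <-> (X1 D `&` X3 D) w /\ (X2 D `&` X4 D) w.
  by split=> [[[[w1 w2] w3] w4]|[[w1 w3] [w2 w4]]].
by rewrite X13E X24E; split=> [[[fw wm] [_ wM]]|[fw wm wM]].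
Qed.

Lemma feasible_rowsup (S : set 'rV[R]_n) b : S !=set0 ->
  (forall w, S w -> feasible w) -> (forall w, S w -> vle w b) ->
  feasible (rowsup S).
Proof.
move=> S0 Sf Sb i; have ub := rowsup_ge Sb; apply/andP; split; last first.
  apply: rowsup_le => // w Sw; have /andP[_ /le_trans] := Sf w Sw i; apply.
  exact/step_m_le/ub.
set l := p_h D * (- (p_g D * p_mu D) - p_g D * (sin (p_alpha D i) + p_c D)).
(* With z the supremum, L_i is inverted: every [w] in [S] has w_i <= (w_(i+1) - l) / a <= (z_(i+1) -
   l) / a, and this bound passes to z_i. *)
rewrite /step -/a -/l -lerBrDr mulrC -ler_pdivlMr ?slope_gt0//.
apply: rowsup_le => // w Sw; have /andP[+ _] := Sf w Sw i.
rewrite /step -/a -/l ler_pdivlMr ?slope_gt0// lerBrDr mulrC => /le_trans; apply.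
exact: ub.
Qed.

Lemma feasible_rowinf (S : set 'rV[R]_n) b : S !=set0 ->
  (forall w, S w -> feasible w) -> (forall w, S w -> vle b w) ->
  feasible (rowinf S).
Proof.
move=> S0 Sf Sb i; have lb := rowinf_le Sb; set y := rowinf S.
apply/andP; split.
  apply: rowinf_ge => // w Sw; have /andP[+ _] := Sf w Sw i; apply: le_trans.
  by rewrite lerD2r ler_wpM2l ?lb// ltW ?slope_gt0.
set U := step i _ _.
(* Since U_i is not affine, [step_m_lip] replaces inversion: y_(i+1) <= w_(i+1) <= U + a (w_i - y_i)
   bounds w_i from below, and the infimum over [w] yields y_(i+1) <= U. *)
suff : (y 0 (Defs.next i) - U) / a + y 0 (cur i) <= y 0 (cur i).
  by rewrite gerDr pmulr_lle0 ?invr_gt0 ?slope_gt0// subr_le0.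
apply: rowinf_ge => // w Sw; have /andP[_ wU] := Sf w Sw i.
rewrite -lerBrDr ler_pdivrMr ?slope_gt0// mulrC.
have := step_m_lip i (lb w Sw (cur i)); have := lb w Sw (Defs.next i).
rewrite -/y -/U; lra.
Qed.

(* A solution of f_i = 0 for all i is feasible; it is a ^+ k * t + p_k, which
   takes arbitrarily large or small values as a > 0. *)
Lemma feasible_affine : exists p : 'I_n -> R, forall t,
  feasible (\row_k (a ^+ k * t + p k)).
Proof.
(* [insub] extends the constant terms to all naturals so that [p] is a plain recursion; the default
   0 is never reached at an index [i]. *)
pose b k := if insub k is Some i then
  p_h D * (- (p_g D * (sin (p_alpha D i) + p_c D))) else 0.
pose p := fix p k := if k is k'.+1 then a * p k' + b k' else 0.
exists (fun k => p k) => t i; rewrite !mxE /=.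
have -> : b i = p_h D * (0 - p_g D * (sin (p_alpha D i) + p_c D)).
  by rewrite /b valK sub0r.
have E : a ^+ i.+1 * t + (a * p i + p_h D * (0 - p_g D *
  (sin (p_alpha D i) + p_c D))) = step i 0 (a ^+ i * t + p i).
  by rewrite /step -/a exprS; ring.
rewrite E !lerD2l !ler_pM2l ?p_h_gt0// !lerD2r oppr_le0 (ltW (m_gt0 _)) andbT.
by rewrite mulr_ge0// ltW ?p_g_gt0 ?p_mu_gt0.
Qed.

(** Entry k reaches b_k once t >= [d k], and the sum of all |d_j| exceeds or equals every such
    threshold. *)
Lemma feasible_ge b : exists2 w, feasible w & vle b w.
Proof.
have [p fp] := feasible_affine; pose d k := (b 0 k - p k) / a ^+ k.
exists (\row_k (a ^+ k * (\sum_j `|d j|) + p k)) => // k; rewrite mxE.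
rewrite -lerBlDr mulrC -ler_pdivrMr ?exprn_gt0 ?slope_gt0// -/(d k).
by rewrite (bigD1 k)//= (le_trans (ler_norm _))// lerDl sumr_ge0.
Qed.

Lemma feasible_le b : exists2 w, feasible w & vle w b.
Proof.
have [p fp] := feasible_affine; pose d k := (b 0 k - p k) / a ^+ k.
exists (\row_k (a ^+ k * (- \sum_j `|d j|) + p k)) => // k; rewrite mxE.
rewrite -lerBrDr mulrC -ler_pdivlMr ?exprn_gt0 ?slope_gt0// -/(d k).
rewrite lerNl (bigD1 k)//= (le_trans (ler_norm _))// normrN lerDl.
exact: sumr_ge0.
Qed.

End Step.

Theorem proposition7p2 (R : realType) (n : nat) (n_ge2 : (2 <= n)%N)
    (D : data R n)
    (Hstep : 0 <= 1 - p_h D * p_gamma D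
                  - p_h D * (p_Pmax D / (2 * p_M D * p_wbar D `^ (3 / 2)))) :
  exists z y : 'rV[R]_n,
    [/\ coord_max (X2 D `&` X4 D) z,
        coord_min (X1 D `&` X3 D) y,
        X D !=set0 <-> vle y z
      & X D !=set0 ->
        exists z' y' : 'rV[R]_n,
          [/\ coord_max (X D) z', coord_min (X D) y', z' = z & y' = y]].
Proof.
have vtrans (u v w : 'rV[R]_n) : vle u v -> vle v w -> vle u w.
  by move=> uv vw i; apply: le_trans (vw i).
pose S24 := X2 D `&` X4 D; pose S13 := X1 D `&` X3 D.
have S24f w : S24 w -> feasible D w by case/X24E.
have S24b w : S24 w -> vle w (p_wmax D) by case/X24E.
have S13f w : S13 w -> feasible D w by case/X13E.
have S13b w : S13 w -> vle (wmin D) w by case/X13E.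
have S24_0 : S24 !=set0.
  by have [w fw wb] := feasible_le Hstep (p_wmax D); exists w; apply/X24E.
have S13_0 : S13 !=set0.
  by have [w fw wb] := feasible_ge Hstep (wmin D); exists w; apply/X13E.
have zub w : S24 w -> vle w (rowsup S24) by apply: rowsup_ge S24b.
have ylb w : S13 w -> vle (rowinf S13) w by apply: rowinf_le S13b.
have fz := feasible_rowsup Hstep S24_0 S24f S24b.
have fy := feasible_rowinf Hstep S13_0 S13f S13b.
have zb : vle (rowsup S24) (p_wmax D).
  by move=> i; apply: rowsup_le => // w /S24b.
have yb : vle (wmin D) (rowinf S13).
  by move=> i; apply: rowinf_ge => // w /S13b.
have X24 w : X D w -> S24 w by case/XE => *; apply/X24E.
have X13 w : X D w -> S13 w by case/XE => *; apply/X13E.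
have Xyz : X D !=set0 -> vle (rowinf S13) (rowsup S24).
  by move=> [w Xw]; apply: vtrans (zub _ (X24 _ Xw)); apply/ylb/X13.
(* The bound that z lacks comes from [wmin] <= y <= z; dually, y <= z <= [p_wmax]. *)
have Xz : vle (rowinf S13) (rowsup S24) -> X D (rowsup S24).
  by move=> yz; apply/XE; split=> //; apply: vtrans yz.
have Xy : vle (rowinf S13) (rowsup S24) -> X D (rowinf S13).
  by move=> yz; apply/XE; split=> //; apply: vtrans zb.
exists (rowsup S24), (rowinf S13); split.
- by apply: coord_max_greatest => //; apply/X24E.
- by apply: coord_min_least => //; apply/X13E.
- by split=> // /Xz; exists (rowsup S24).
(* Both vectors now lie in X, which is contained in [S24] and [S13], so they remain extremal
   there. *)
move=> /Xyz yz; exists (rowsup S24), (rowinf S13); split=> //.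
- by apply: coord_max_greatest => [|w /X24 /zub//]; apply: Xz.
- by apply: coord_min_least => [|w /X13 /ylb//]; apply: Xy.
Qed.
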